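(* For each fixed $a>0$ and $x\in(0,1)$, the function $b\mapsto I_x(a,b)$ is strictly log-concave on $(0,\infty)$.
   Context: For $a,b>0$ and $x\in(0,1)$, $I_x(a,b)$ denotes the normalized incomplete beta function $$I_x(a,b)=\frac{\int_0^x t^{a-1}(1-t)^{b-1}\,dt}{\int_0^1 t^{a-1}(1-t)^{b-1}\,dt}.$$ A positive function $f$ is strictly log-concave if $\log f$ is strictly concave. *)

(* Defs.v *)
From HB Require Import structures.
From mathcomp Require Import all_boot all_order all_algebra.
From mathcomp Require Import all_classical all_reals all_analysis.

Set Implicit Arguments.
Unset Strict Implicit.
Unset Printing Implicit Defensive.

Import Order.TTheory GRing.Theory Num.Theory.
Import numFieldNormedType.Exports.

Local Open Scope classical_set_scope.
Local Open Scope ring_scope.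

(* The integration interval is open so that the integrand is never evaluated
   at 0 or 1, where [powR] with a negative exponent takes the value 0. *)
Definition incomplete_beta (R : realType) (x a b : R) : R :=
  \int[@lebesgue_measure R]_(t in `]0, x[) (t `^ (a - 1) * (1 - t) `^ (b - 1)).

Definition normalized_incomplete_beta (R : realType) (x a b : R) : R :=
  incomplete_beta x a b / incomplete_beta 1 a b.

(* [D] is meant to be an interval: the values of [f] at the intermediate points
   are used without checking that these points belong to [D]. *)
Definition strictly_concave_on (R : realType) (D : set R) (f : R -> R) : Prop :=
  forall u v t : R, D u -> D v -> u != v -> 0 < t < 1 ->
    t * f u + (1 - t) * f v < f (t * u + (1 - t) * v).

(* The positivity clause cannot be dropped: [ln] is 0 on nonpositive numbers. *)
Definition strictly_log_concave_on (R : realType) (D : set R) (f : R -> R)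
    : Prop :=
  (forall u : R, D u -> 0 < f u) /\
  strictly_concave_on D (fun u => ln (f u)).

(* Main.v *)
(** Write [F_b(y)] for the incomplete beta integral over [0, y] and [k_b] for its
    integrand.  For [w = t u + (1 - t) v], the function
    [D = t ln F_u + (1 - t) ln F_v - ln F_w] is strictly increasing on ]0, 1[
    and left-continuous at 1, and [D x < D 1] is the claim.  The derivative of
    [D] is positive because, at fixed [y], the function [b |-> k_b / F_b] lies
    strictly above a line touching it at [b = w], with slope
    [- k_w L / F_w^2] where [L(y) = int_0^y F_w / (1 - q) dq].  This tangent
    inequality says [P > 0] for
    [P = (1 - y)^(v - w) F_w^2 - (F_w - (v - w) L) F_v]; functions vanishing at 0
    are compared through their derivatives until only the monotonicity of
    [F_w / (y^(a - 1) (1 - y)^w)] remains. *)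

Require Import Defs.
From HB Require Import structures.
From mathcomp Require Import all_boot all_order all_algebra.
From mathcomp Require Import all_classical all_reals all_analysis.
From mathcomp Require Import measurable_realfun ring lra zify.

Import Order.TTheory GRing.Theory Num.Theory.
Import numFieldNormedType.Exports.

Local Open Scope classical_set_scope.
Local Open Scope ring_scope.

Set Implicit Arguments.
Unset Strict Implicit.
Unset Printing Implicit Defensive.

(** * Differentiation rules on the real line and sign arguments from derivatives *)

Section derive_rules.
Context {R : realType}.
Implicit Types (f g : R -> R) (x : R).

Lemma is_derive1_eq f x df df' :
  is_derive x 1 f df -> df = df' -> is_derive x 1 f df'.
Proof. by move=> ? <-. Qed.

Lemma is_derive1_cst (c x : R) : is_derive x 1 (fun _ : R => c) 0.
Proof. exact: is_derive_cst. Qed.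

Lemma is_derive1_id x : is_derive x 1 (fun y : R => y) 1.
Proof. exact: is_derive_id. Qed.

Lemma is_derive1_add f g x df dg : is_derive x 1 f df -> is_derive x 1 g dg ->
  is_derive x 1 (fun y => f y + g y) (df + dg).
Proof. by move=> hf hg; exact: is_deriveD. Qed.

Lemma is_derive1_sub f g x df dg : is_derive x 1 f df -> is_derive x 1 g dg ->
  is_derive x 1 (fun y => f y - g y) (df - dg).
Proof. by move=> hf hg; exact: is_deriveB. Qed.

Lemma is_derive1_mul f g x df dg : is_derive x 1 f df -> is_derive x 1 g dg ->
  is_derive x 1 (fun y => f y * g y) (df * g x + f x * dg).
Proof.
move=> hf hg; apply: is_derive1_eq (is_deriveM hf hg) _.
by rewrite /GRing.scale/=; ring.
Qed.

Lemma is_derive1_div f g x df dg : is_derive x 1 f df -> is_derive x 1 g dg ->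
  g x != 0 -> is_derive x 1 (fun y => f y / g y) ((df * g x - f x * dg) / g x ^+ 2).
Proof.
move=> hf hg gx0; have hV := is_deriveV gx0 hg.
apply: is_derive1_eq (is_derive1_mul hf hV) _.
by rewrite /GRing.scale/=; field.
Qed.

Lemma is_derive1_ln_comp f x df : is_derive x 1 f df -> 0 < f x ->
  is_derive x 1 (fun y => ln (f y)) (df / f x).
Proof.
move=> hf fx0; have hl := is_derive1_ln fx0.
have h : is_derive x 1 (fun y => ln (f y)) ((f x)^-1 * df) := is_derive1_comp hl hf.
by apply: is_derive1_eq h _; rewrite mulrC.
Qed.

Lemma is_derive1_pow (p x : R) : 0 < x ->
  is_derive x 1 (fun y => y `^ p) (p * x `^ p / x).
Proof.
move=> x0; apply: is_derive1_eq (is_derive1_powR p x0) _.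
by rewrite powRB ?powRr1 ?(ltW x0) ?(gt_eqF x0) ?implybT// mulrA.
Qed.

Lemma is_derive1_pow_onem (p x : R) : x < 1 ->
  is_derive x 1 (fun y => (1 - y) `^ p) (- (p * (1 - x) `^ p / (1 - x))).
Proof.
move=> x1; have x0 : 0 < 1 - x by rewrite subr_gt0.
have hp := is_derive1_pow p x0.
have h1 : is_derive x 1 (fun y : R => 1 - y) (0 - 1).
  exact: is_derive1_sub (is_derive1_cst _ _) (is_derive1_id _).
have h : is_derive x 1 (fun y => (1 - y) `^ p)
    (p * (1 - x) `^ p / (1 - x) * (0 - 1)).
  exact: (@is_derive1_comp _ (fun y => y `^ p) (fun y => 1 - y) _ _ _ hp h1).
by apply: is_derive1_eq h _; rewrite sub0r mulrN1.
Qed.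

Lemma cvg_at_right_eq f x (l l' : R) :
  f y @[y --> x^'+] --> l -> l = l' -> f y @[y --> x^'+] --> l'.
Proof. by move=> ? <-. Qed.

Lemma continuous_pow_onem (p : R) :
  {for 0, continuous (fun y : R => (1 - y) `^ p)}.
Proof.
have [d _] := is_derive1_pow_onem p (@ltr01 R).
by apply: differentiable_continuous; exact/derivable1_diffP.
Qed.

Lemma derive1_gt0_lt f df (c d : R) :
  (forall y, c < y < d -> is_derive y 1 f (df y)) ->
  (forall y, c < y < d -> 0 < df y) ->
  forall y z, c < y -> y < z -> z < d -> f y < f z.
Proof.
move=> hf df0 y z cy yz zd.
apply: (@gtr0_derive1_lt_oo _ f c d) => //.
- by move=> t; rewrite in_itv/= => /hf[].
- by move=> t; rewrite in_itv/= => td; rewrite derive1E; case: (hf _ td) => _ ->; exact: df0.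
- move=> t; rewrite inE/= in_itv/= => /hf[dt _].
  by apply: differentiable_continuous; exact/derivable1_diffP.
- by rewrite in_itv/= cy (lt_trans yz).
- by rewrite in_itv/= zd (lt_trans cy).
Qed.

(* The minorant [h] lets [f] itself have no limit at 0: in the uses below [f]
   contains a term whose limit would need a separate proof. *)
Lemma derive1_gt0_gt0 f df h (d : R) :
  (forall y, 0 < y < d -> is_derive y 1 f (df y)) ->
  (forall y, 0 < y < d -> 0 < df y) ->
  (forall y, 0 < y < d -> h y <= f y) -> h y @[y --> 0^'+] --> (0 : R) ->
  forall y, 0 < y < d -> 0 < f y.
Proof.
move=> hf df0 hlef h0 y /andP[y0 yd].
(* The limit of [h] at 0 only yields [0 <= f (y / 2)]; the strict increase from [y / 2] to [y]
   restores strictness. *)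
have y20 : 0 < y / 2 by rewrite divr_gt0.
have y2y : y / 2 < y by lra.
apply: le_lt_trans (derive1_gt0_lt hf df0 y20 y2y yd).
rewrite -(cvg_lim _ h0)//; apply: limr_le; first by apply/cvg_ex; exists 0.
near=> z.
have zd : 0 < z < d.
  apply/andP; split; first by near: z; exact: nbhs_right_gt.
  by near: z; apply: nbhs_right_lt; exact: lt_trans y0 yd.
have z2 : z < y / 2 by near: z; apply: nbhs_right_lt.
apply: (le_trans (hlef _ zd)); apply/ltW.
case/andP: zd => z0 _.
exact: derive1_gt0_lt hf df0 _ _ z0 z2 (lt_trans y2y yd).
Unshelve. all: by end_near. Qed.

End derive_rules.

(** * The tangent inequality, for functions known only through their derivative and their limit at
    0 *)

Definition beta_density {R : realType} (a b y : R) : R :=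
  y `^ (a - 1) * (1 - y) `^ (b - 1).

Section beta_primitive.
Context {R : realType}.
Variables (a w : R) (F : R -> R).
Hypotheses (a_gt0 : 0 < a) (w_gt0 : 0 < w).
Hypothesis dF : forall y : R, 0 < y < 1 -> is_derive y 1 F (beta_density a w y).
Hypothesis F_cvg0 : F y @[y --> 0^'+] --> (0 : R).

Lemma beta_density_gt0 b (y : R) : 0 < y < 1 -> 0 < beta_density a b y.
Proof.
by move=> /andP[y0 y1]; rewrite mulr_gt0// powR_gt0// subr_gt0.
Qed.

Lemma powR_pred (p y : R) : 0 < y -> y `^ (p - 1) = y `^ p / y.
Proof.
by move=> y0; rewrite powRB ?powRr1 ?(ltW y0) ?(gt_eqF y0) ?implybT.
Qed.

Lemma beta_primitive_gt0 (y : R) : 0 < y < 1 -> 0 < F y.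
Proof.
exact: (derive1_gt0_gt0 dF (@beta_density_gt0 w) (fun y _ => lexx _) F_cvg0).
Qed.

(** This is [1 - y] times the density, chosen so that [F / g] times the derivative of [F] is
    [F / (1 - y)], the derivative of [L] below. *)
Let g (y : R) := y `^ (a - 1) * (1 - y) `^ w.

Let g_gt0 (y : R) : 0 < y < 1 -> 0 < g y.
Proof.
by move=> /andP[y0 y1]; rewrite mulr_gt0// powR_gt0// subr_gt0.
Qed.

Let g_neq0 (y : R) : 0 < y < 1 -> g y != 0.
Proof. by move=> y01; rewrite gt_eqF ?g_gt0. Qed.

Let y_neq0 (y : R) : 0 < y < 1 -> y != 0.
Proof. by move=> /andP[y0 _]; rewrite gt_eqF. Qed.

Let onem_neq0 (y : R) : 0 < y < 1 -> 1 - y != 0.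
Proof. by move=> /andP[_ y1]; rewrite subr_eq0 gt_eqF. Qed.

Let densityE (y : R) : 0 < y < 1 -> beta_density a w y = g y / (1 - y).
Proof.
by move=> /andP[y0 y1]; rewrite /beta_density (powR_pred w) ?subr_gt0// mulrA.
Qed.

Let dg (y : R) : 0 < y < 1 ->
  is_derive y 1 g (g y * ((a - 1) / y - w / (1 - y))).
Proof.
move=> y01; have /andP[y0 y1] := y01.
apply: is_derive1_eq
  (is_derive1_mul (is_derive1_pow _ y0) (is_derive1_pow_onem _ y1)) _.
by rewrite /g; field; rewrite ?onem_neq0 ?g_neq0 ?y_neq0.
Qed.

(* This is the positivity of the logarithmic derivative of
   [F y / (y `^ (a - 1) * (1 - y) `^ w)]. *)
Lemma beta_primitive_lt (y : R) : 0 < y < 1 ->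
  F y * ((a - 1) * (1 - y) - w * y) < y * g y.
Proof.
(* If [a + w < 1], then [a < 1] and the left side is negative. Otherwise the right side minus the
   left side has derivative [g + F * (a + w - 1)], the remaining terms cancelling, and this is
   positive. *)
have [aw1|aw1] := leP 1 (a + w); last first.
  move=> y01; have /andP[y0 y1] := y01.
  apply: (@lt_trans _ _ 0); last by rewrite mulr_gt0// g_gt0.
  rewrite pmulr_rlt0 ?beta_primitive_gt0//.
  have : 0 < w * y by rewrite mulr_gt0.
  have a1 : a < 1 by apply: le_lt_trans aw1; rewrite lerDl ltW.
  have : 0 < (1 - a) * (1 - y) by rewrite mulr_gt0// subr_gt0.
  lra.
move=> y01; rewrite -subr_gt0; move: y y01.
pose T y := y * g y - F y * ((a - 1) * (1 - y) - w * y).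
apply: (@derive1_gt0_gt0 _ T (fun y => g y + F y * (a + w - 1)) T) => //.
- move=> y y01; have /andP[y0 y1] := y01.
  have hid := is_derive1_id y.
  have hc c := is_derive1_cst c y.
  have h1 := is_derive1_mul hid (dg y01).
  have h2 := is_derive1_sub
    (is_derive1_mul (hc (a - 1)) (is_derive1_sub (hc 1) hid))
    (is_derive1_mul (hc w) hid).
  have h3 := is_derive1_sub h1 (is_derive1_mul (dF y01) h2).
  apply: is_derive1_eq h3 _.
  by rewrite /= densityE//; field; rewrite ?onem_neq0 ?g_neq0 ?y_neq0.
- move=> y y01; have := g_gt0 y01.
  have : 0 <= F y * (a + w - 1).
    by rewrite mulr_ge0 ?(ltW (beta_primitive_gt0 y01))// subr_ge0.
  lra.
- have idE : y @[y --> 0^'+] --> (0 : R) by apply: cvg_at_right_filter; exact: cvg_id.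
  have cstE (c : R) : c @[y --> (0 : R)^'+] --> c by exact: cvg_cst.
  have h1 : y * g y @[y --> 0^'+] --> (0 : R).
    have h : (1 - y) `^ w @[y --> 0^'+] --> (1 - 0 : R) `^ w.
      exact/cvg_at_right_filter/continuous_pow_onem.
    (* For [a < 1] the factor [y ^ (a - 1)] is unbounded near 0, so [y] is absorbed into it before
       passing to the limit. *)
    apply: (@cvg_trans _ (y `^ a * (1 - y) `^ w @[y --> 0^'+])); last first.
      by refine (cvg_at_right_eq (cvgM (powR_cvg0 a_gt0) h) _); rewrite mul0r.
    apply: near_eq_cvg; near=> y.
    have y0 : 0 < y by near: y; exact: nbhs_right_gt.
    by rewrite /g mulrA mulr_powRB1// ltW.
  refine (cvg_at_right_eq (cvgB h1 (cvgM F_cvg0 (cvgB (cvgM (cstE (a - 1))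
    (cvgB (cstE 1) idE)) (cvgM (cstE w) idE)))) _).
  by rewrite mul0r subr0.
Unshelve. all: by end_near. Qed.

Variable L : R -> R.
Hypothesis dL : forall y : R, 0 < y < 1 -> is_derive y 1 L (F y / (1 - y)).
Hypothesis L_cvg0 : L y @[y --> 0^'+] --> (0 : R).

Let rho y := F y / g y.

Let drho (y : R) : 0 < y < 1 -> is_derive y 1 rho
  ((y * g y - F y * ((a - 1) * (1 - y) - w * y)) / (y * (1 - y) * g y)).
Proof.
move=> y01; have /andP[y0 y1] := y01.
apply: is_derive1_eq (is_derive1_div (dF y01) (dg y01) _) _.
  by rewrite gt_eqF// g_gt0.
rewrite densityE//; field.
by rewrite ?onem_neq0 ?g_neq0 ?y_neq0.
Qed.

Let drho_gt0 (y : R) : 0 < y < 1 ->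
  0 < (y * g y - F y * ((a - 1) * (1 - y) - w * y)) / (y * (1 - y) * g y).
Proof.
move=> y01; have /andP[y0 y1] := y01.
apply: divr_gt0; first by rewrite subr_gt0 beta_primitive_lt.
by rewrite mulr_gt0 ?g_gt0// mulr_gt0// subr_gt0.
Qed.

(** Since [rho * F' = L'], the derivative of [rho * F - L] reduces to [rho' * F], and [rho] is
    increasing. *)
Let L_lt (y : R) : 0 < y < 1 -> L y < rho y * F y.
Proof.
move=> y01; rewrite -subr_gt0; move: y y01.
apply: (@derive1_gt0_gt0 _ (fun y => rho y * F y - L y) _ (fun y => - L y)).
- move=> y y01.
  exact: is_derive1_sub (is_derive1_mul (drho y01) (dF y01)) (dL y01).
- move=> y y01; have /andP[y0 y1] := y01.
  rewrite densityE// /rho.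
  have -> : F y / g y * (g y / (1 - y)) = F y / (1 - y).
    by field; rewrite ?onem_neq0 ?g_neq0 ?y_neq0.
  by rewrite addrK mulr_gt0 ?drho_gt0 ?beta_primitive_gt0.
- move=> y y01; rewrite lerDr.
  by rewrite /rho -mulrA mulrCA ?mulr_ge0 ?invr_ge0 ?ltW ?g_gt0 ?beta_primitive_gt0.
- by refine (cvg_at_right_eq (cvgN L_cvg0) _); rewrite oppr0.
Qed.

Variables (v : R) (Fv : R -> R).
Hypothesis v_neq_w : v != w.
Hypothesis dFv : forall y : R, 0 < y < 1 -> is_derive y 1 Fv (beta_density a v y).
Hypothesis Fv_cvg0 : Fv y @[y --> 0^'+] --> (0 : R).

Let d := v - w.
Let d_cvg : d @[y --> (0 : R)^'+] --> d.
Proof. exact: cvg_cst. Qed.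

Let X (y : R) := (1 - y) `^ d.
Let N y := Fv y - X y * F y.

Let X_gt0 (y : R) : 0 < y < 1 -> 0 < X y.
Proof. by move=> /andP[y0 y1]; rewrite powR_gt0// subr_gt0. Qed.

Let density_vE (y : R) : 0 < y < 1 -> beta_density a v y = g y * X y / (1 - y).
Proof.
move=> /andP[y0 y1]; rewrite /beta_density (powR_pred v) ?subr_gt0// /g /X /d.
rewrite -!mulrA; congr (_ * _); rewrite !mulrA; congr (_ / _).
by rewrite -powRD ?subrKC// subr_eq0 (gt_eqF y1) implybT.
Qed.

Let dX (y : R) : 0 < y < 1 -> is_derive y 1 X (- (d * X y / (1 - y))).
Proof. by move=> /andP[y0 y1]; exact: is_derive1_pow_onem. Qed.

Let X_cvg : X y @[y --> 0^'+] --> X 0.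
Proof.
exact/cvg_at_right_filter/continuous_pow_onem.
Qed.

Let N_cvg0 : N y @[y --> 0^'+] --> (0 : R).
Proof. by refine (cvg_at_right_eq (cvgB Fv_cvg0 (cvgM X_cvg F_cvg0)) _); rewrite mulr0 subr0. Qed.

(** [X] is the ratio of the two densities, so the density terms cancel and only [- X' * F] is
    left. *)
Let dN (y : R) : 0 < y < 1 -> is_derive y 1 N (d * X y * F y / (1 - y)).
Proof.
move=> y01; have /andP[y0 y1] := y01.
apply: is_derive1_eq
  (is_derive1_sub (dFv y01) (is_derive1_mul (dX y01) (dF y01))) _.
by rewrite density_vE// densityE//; field; rewrite ?onem_neq0 ?g_neq0 ?y_neq0.
Qed.

Let d2_gt0 : 0 < d ^+ 2.
Proof. by rewrite exprn_even_gt0//= subr_eq0. Qed.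

(** The factor [d] turns the derivative of [N] into a multiple of [d ^+ 2], which treats [v < w] and
    [v > w] at once. *)
Let dN_gt0 (y : R) : 0 < y < 1 -> 0 < d * N y.
Proof.
apply: (@derive1_gt0_gt0 _ (fun y => d * N y)
  (fun y => d ^+ 2 * X y * F y / (1 - y)) (fun y => d * N y)).
- move=> z y01; apply: is_derive1_eq
    (is_derive1_mul (is_derive1_cst d z) (dN y01)) _.
  by rewrite /=; ring.
- move=> z y01; have /andP[y0 y1] := y01.
  by rewrite divr_gt0 ?subr_gt0// mulr_gt0 ?beta_primitive_gt0// mulr_gt0 ?X_gt0.
- by move=> z _; exact: lexx.
- by refine (cvg_at_right_eq (cvgM d_cvg N_cvg0) _); rewrite mulr0.
Qed.

(** The subtracted term removes the part of [N'] of first order in [d]: the term in [L'] cancels it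
    and a multiple of [d ^+ 2] remains. *)
Let Q y := N y - d * X y * L y.

Let dQ (y : R) : 0 < y < 1 -> is_derive y 1 Q (d ^+ 2 * X y * L y / (1 - y)).
Proof.
move=> y01; have /andP[y0 y1] := y01.
apply: is_derive1_eq (is_derive1_sub (dN y01)
  (is_derive1_mul (is_derive1_mul (is_derive1_cst d y) (dX y01)) (dL y01))) _.
by rewrite /=; field; rewrite ?onem_neq0 ?g_neq0 ?y_neq0.
Qed.

Let Q_cvg0 : Q y @[y --> 0^'+] --> (0 : R).
Proof.
refine (cvg_at_right_eq (cvgB N_cvg0 (cvgM (cvgM d_cvg X_cvg) L_cvg0)) _).
by rewrite mulr0 subr0.
Qed.

(** The derivative of the difference is [rho' * (d * N)] plus a positive multiple of [rho * F - L];
    [dN_gt0] and [L_lt] make both terms positive. *)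
Let Q_lt (y : R) : 0 < y < 1 -> Q y < rho y * (d * N y).
Proof.
move=> y01; rewrite -subr_gt0; move: y y01.
apply: (@derive1_gt0_gt0 _ (fun y => rho y * (d * N y) - Q y) _
  (fun y => - Q y)).
- move=> y y01.
  exact: is_derive1_sub (is_derive1_mul (drho y01)
    (is_derive1_mul (is_derive1_cst d y) (dN y01))) (dQ y01).
- move=> y y01; have /andP[y0 y1] := y01.
  rewrite /= mul0r add0r -addrA addr_gt0//.
    by rewrite mulr_gt0 ?drho_gt0 ?dN_gt0.
  have -> : rho y * (d * (d * X y * F y / (1 - y))) -
      d ^+ 2 * X y * L y / (1 - y) =
      d ^+ 2 * X y / (1 - y) * (rho y * F y - L y) by ring.
  by rewrite mulr_gt0 ?subr_gt0 ?L_lt// divr_gt0 ?subr_gt0// mulr_gt0 ?X_gt0.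
- move=> y y01; rewrite lerDr.
  by rewrite mulr_ge0 ?divr_ge0 ?ltW ?g_gt0 ?beta_primitive_gt0 ?dN_gt0.
- by refine (cvg_at_right_eq (cvgN Q_cvg0) _); rewrite oppr0.
Qed.

(** The derivative of the difference factors as the density times [rho * (d * N) - Q], which is
    positive by [Q_lt]. *)
Let P_gt0 (y : R) : 0 < y < 1 -> (F y - d * L y) * Fv y < X y * F y ^+ 2.
Proof.
move=> y01; rewrite -subr_gt0; move: y y01.
pose P y := X y * (F y * F y) - (F y - d * L y) * Fv y.
apply: (@derive1_gt0_gt0 _ P
  (fun y => g y / (1 - y) * (rho y * (d * N y) - Q y)) P) => //.
- move=> y y01; have /andP[y0 y1] := y01.
  apply: is_derive1_eq (is_derive1_sub
    (is_derive1_mul (dX y01) (is_derive1_mul (dF y01) (dF y01)))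
    (is_derive1_mul (is_derive1_sub (dF y01)
       (is_derive1_mul (is_derive1_cst d y) (dL y01))) (dFv y01))) _.
  rewrite /= density_vE// densityE// /Q /N /rho.
  by field; rewrite ?onem_neq0 ?g_neq0 ?y_neq0.
- move=> y y01; have /andP[y0 y1] := y01.
  by rewrite mulr_gt0 ?subr_gt0 ?Q_lt// divr_gt0 ?g_gt0 ?subr_gt0.
- refine (cvg_at_right_eq (cvgB (cvgM X_cvg (cvgM F_cvg0 F_cvg0))
    (cvgM (cvgB F_cvg0 (cvgM d_cvg L_cvg0)) Fv_cvg0)) _).
  by rewrite !mulr0 subr0.
Qed.

(** The quotient of density by primitive is the reversed hazard rate of the beta distribution, its
    normalization cancelling. Over a common denominator the two sides differ by a positive multiple
    of the difference in [P_gt0]. *)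
Lemma reversed_hazard_tangent (y : R) : 0 < y < 1 ->
  beta_density a w y / F y -
    (v - w) * (beta_density a w y * L y / F y ^+ 2)
  < beta_density a v y / Fv y.
Proof.
move=> y01; have /andP[y0 y1] := y01.
have Fv_gt0 : 0 < Fv y.
  exact: (derive1_gt0_gt0 dFv (@beta_density_gt0 v) (fun y _ => lexx _) Fv_cvg0).
have F_gt0 := beta_primitive_gt0 y01.
rewrite density_vE// densityE// -/d -subr_gt0.
have -> : g y * X y / (1 - y) / Fv y -
   (g y / (1 - y) / F y - d * (g y / (1 - y) * L y / F y ^+ 2)) =
   g y / (1 - y) / (Fv y * F y ^+ 2) *
   (X y * F y ^+ 2 - (F y - d * L y) * Fv y).
  by field; rewrite onem_neq0//= !gt_eqF.
rewrite mulr_gt0 ?subr_gt0 ?P_gt0// !divr_gt0 ?subr_gt0 ?g_gt0//.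
by rewrite mulr_gt0// exprn_gt0.
Qed.

End beta_primitive.

(** * Integrals over open intervals as functions of their upper endpoint *)

Section open_interval_primitive.
Context {R : realType}.
Notation mu := (@lebesgue_measure R).
Implicit Types (f G : R -> R) (a b c : R).

(** Endpoints are null sets; the closed form is what the fundamental theorem of calculus takes
    below. *)
Lemma integrable_itv_oo_cc f a b : mu.-integrable `]a, b[ (EFin \o f) ->
  mu.-integrable `[a, b] (EFin \o f).
Proof.
move=> /integrableP[mf foo].
have mf1 : measurable_fun `]a, b[ f by exact/measurable_EFinP.
have mf2 : measurable_fun `[a, b[ f by exact/measurable_fun_itv_obnd_cbndP.
have mf3 : measurable_fun `[a, b] f by exact/measurable_fun_itv_bndo_bndcP.
apply/integrableP; split; first exact/measurable_EFinP.
rewrite -integral_itv_bndo_bndc.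
  rewrite -integral_itv_obnd_cbnd//.
  by apply: measurableT_comp => //; exact/measurable_EFinP.
by apply: measurableT_comp => //; exact/measurable_EFinP.
Qed.

Lemma continuous_measurable_itvoo f a b :
  {in `]a, b[, continuous f} -> measurable_fun `]a, b[ f.
Proof.
move=> cf; apply: open_continuous_measurable_fun => //.
by move=> x; rewrite inE => /cf.
Qed.

(** The integrals over compact intervals exhausting []0, 1[] are differences of two values of [G],
    hence at most [2 C]; monotone convergence carries the bound to the limit. *)
Lemma integrable_bounded_primitive f G (C : R) :
  (forall x : R, 0 < x < 1 -> 0 <= f x) ->
  {in `]0, 1[, continuous f} ->
  (forall x : R, 0 < x < 1 -> is_derive x 1 G (f x)) ->
  (forall x : R, 0 < x < 1 -> `|G x| <= C) ->
  mu.-integrable `]0, 1[ (EFin \o f).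
Proof.
move=> f0 cf dG GC.
have mf := continuous_measurable_itvoo cf.
apply/integrableP; split; first exact/measurable_EFinP.
(* Starting at 1/3 keeps [u n] below 1/2, so every interval [[u n, 1 - u n]] is nondegenerate. *)
pose u (n : nat) : R := n.+3%:R^-1.
have u_gt0 n : 0 < u n by rewrite invr_gt0.
have u_lt2 n : u n < 2^-1 by rewrite ltf_pV2 ?posrE// ltr_nat.
have uS n : u n.+1 <= u n by rewrite lef_pV2 ?posrE// ler_nat.
pose A (n : nat) : set R := `[u n, 1 - u n]%classic.
have A01 n (x : R) : A n x -> 0 < x < 1.
  rewrite /A/= in_itv/= => /andP[xl xr]; have := u_gt0 n.
  by move=> ?; apply/andP; split; lra.
have AE : \bigcup_n A n = `]0, 1[%classic.
  apply/seteqP; split => x /=.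
    by move=> [n _ /A01]; rewrite in_itv.
  rewrite in_itv/= => /andP[x0 x1].
  have m0 : 0 < Num.min x (1 - x) by rewrite lt_min x0 subr_gt0.
  have [n _ /(_ n (leqnn n)) nm] := near_infty_natSinv_lt (PosNum m0).
  exists n => //; rewrite /A/= in_itv/=.
  have nn : u n <= n.+1%:R^-1 by rewrite lef_pV2 ?posrE// ler_nat; lia.
  move: nm; rewrite lt_min /= => /andP[nx nx1].
  have ux := le_lt_trans nn nx; have ux1 := le_lt_trans nn nx1.
  by apply/andP; split; lra.
have ndA : nondecreasing_seq A.
  apply/nondecreasing_seqP => n; rewrite subsetEset => x.
  rewrite /A/= !in_itv/= => /andP[xl xr]; have := uS n.
  by move=> ?; apply/andP; split; lra.
have fE (x : R) : 0 < x < 1 -> `|(f x)%:E|%E = (f x)%:E.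
  by move=> x01; rewrite gee0_abs// lee_fin f0.
have -> : (\int[mu]_(x in `]0%R, 1%R[) `|(EFin \o f) x| =
           \int[mu]_(x in `]0%R, 1%R[) (f x)%:E)%E.
  by apply: eq_integral => x; rewrite inE/= in_itv/= => /fE.
rewrite -AE; apply: (@le_lt_trans _ _ (C *+ 2)%:E); last by rewrite ltry.
have := @ge0_nondecreasing_set_cvg_integral _ (measurableTypeR R) R A
  (EFin \o f) mu ndA.
have mA n : measurable (A n) by exact: measurable_itv.
have mfA n : measurable_fun (A n) (EFin \o f).
  apply/measurable_EFinP; apply: measurable_funS mf => // x /A01.
  by rewrite /= in_itv.
have f0A n x : A n x -> (0 <= (EFin \o f) x)%E.
  by move=> /A01 x01; rewrite lee_fin f0.
move=> /(_ mA mfA f0A) h; rewrite -(cvg_lim _ h)//.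
apply: lime_le; first by apply/cvg_ex; eexists; exact: h.
apply: nearW => n.
have nn : u n < 1 - u n by have := u_lt2 n; lra.
have Gc (x : R) : 0 < x < 1 -> {for x, continuous G}.
  by move=> /dG[dx _]; apply: differentiable_continuous; exact/derivable1_diffP.
have Al : A n (u n) by rewrite /A/= in_itv/= lexx ltW.
have Ar : A n (1 - u n) by rewrite /A/= in_itv/= lexx ltW.
rewrite /A (@continuous_FTC2 _ f G)//.
- rewrite -EFinB lee_fin mulr2n; apply: (le_trans (ler_norm _)).
  by apply: (le_trans (ler_normB _ _)); rewrite lerD// GC// (A01 n).
- apply: continuous_in_subspaceT => x; rewrite inE => /A01 x01.
  by apply: cf; rewrite in_itv.
- split.
  + by move=> x xA; case: (dG x) => //; apply: (A01 n); exact: subset_itv_oo_cc.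
  + by apply: cvg_at_right_filter; apply: Gc; exact: (A01 n).
  + by apply: cvg_at_left_filter; apply: Gc; exact: (A01 n).
- move=> x xA; rewrite derive1E; case: (dG x) => //.
  by apply: (A01 n); exact: subset_itv_oo_cc.
Qed.

Variables (f : R -> R) (c : R).
Hypotheses (c_gt0 : 0 < c) (f_int : mu.-integrable `]0, c[ (EFin \o f)).

Let Jf y := \int[mu]_(t in `]0, y[) f t.

(** Beyond [c] nothing is known about integrability, so the later lemmas use this identity only near
    a point or on the left of [c]. *)
Let JfE y : y <= c -> Jf y = parameterized_integral mu 0 y f.
Proof.
move=> yc; rewrite /Jf /parameterized_integral.
have fy : mu.-integrable `]0, y[ (EFin \o f).
  apply: integrableS f_int => //=.
  by apply: subset_itvl; rewrite bnd_simp.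
rewrite Rintegral_itv_bndo_bndc// Rintegral_itv_obnd_cbnd//.
by apply: integrableS (integrable_itv_oo_cc fy) => //; exact: subset_itv_oc_cc.
Qed.

Lemma Rintegral_oo_cvg_right : Jf y @[y --> 0^'+] --> (0 : R).
Proof.
apply: (@cvg_trans _ (parameterized_integral mu 0 y f @[y --> 0^'+])).
  apply: near_eq_cvg; near=> y.
  have yc : y <= c by near: y; exact: nbhs_right_le.
  by rewrite JfE.
apply: cvg_at_right_filter.
exact: parameterized_integral_cvg_left c_gt0 (integrable_itv_oo_cc f_int).
Unshelve. all: by end_near. Qed.

Lemma Rintegral_oo_cvg_left : Jf y @[y --> c^'-] --> Jf c.
Proof.
rewrite (JfE (lexx c)).
apply: (@cvg_trans _ (parameterized_integral mu 0 y f @[y --> c^'-])).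
  apply: near_eq_cvg; near=> y.
  have yc : y <= c by near: y; exact: nbhs_left_le.
  by rewrite JfE.
exact: parameterized_integral_cvg_at_left c_gt0 (integrable_itv_oo_cc f_int).
Unshelve. all: by end_near. Qed.

Lemma is_derive_Rintegral_oo y : 0 < y < c -> {for y, continuous f} ->
  is_derive y 1 Jf (f y).
Proof.
move=> /andP[y0 yc] cf.
have [dP PE] := continuous_FTC1_closed yc (integrable_itv_oo_cc f_int) y0 cf.
have PD : is_derive y 1 (parameterized_integral mu 0 ^~ f) (f y).
  by split; [exact: dP|rewrite -derive1E].
apply: near_eq_is_derive PD.
near=> z; have zc : z <= c by apply/ltW; near: z; exact: lt_nbhsl.
by rewrite JfE.
Unshelve. all: by end_near. Qed.

End open_interval_primitive.

(** * Integrability, positivity and the tangent inequality for the incomplete beta integral *)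

Section incomplete_beta.
Context {R : realType}.
Notation mu := (@lebesgue_measure R).
Implicit Types a b u v w x y : R.

Lemma is_derive1_continuous (f : R -> R) (x df : R) :
  is_derive x 1 f df -> {for x, continuous f}.
Proof.
by move=> [d _]; apply: differentiable_continuous; exact/derivable1_diffP.
Qed.

Lemma continuous_beta_density a b y : 0 < y < 1 ->
  {for y, continuous (beta_density a b)}.
Proof.
move=> /andP[y0 y1]; apply: is_derive1_continuous.
exact: is_derive1_mul (is_derive1_pow _ y0) (is_derive1_pow_onem _ y1).
Qed.

Lemma pow_le1 (p y : R) : 0 < p -> 0 < y < 1 -> y `^ p <= 1.
Proof.
move=> p0 /andP[y0 y1]; have := ge0_ler_powR (ltW p0) (ltW y0) ler01 (ltW y1).
by rewrite powR1.
Qed.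

Lemma integrable_beta_density a b : 0 < a -> 0 < b ->
  mu.-integrable `]0, 1[ (EFin \o beta_density a b).
Proof.
move=> a0 b0.
(* [beta_density a b <= f] because the factor that is not singular is at most 1
   after writing [1 = (1 - y) + y]. *)
pose f y := y `^ (a - 1) + (1 - y) `^ (b - 1).
(* A primitive of [f]; it is bounded by [a^-1 + b^-1] because positive powers are at most 1 on []0,
   1[]. *)
pose G y := y `^ a / a - (1 - y) `^ b / b.
have oneB y : 0 < y < 1 -> 0 < 1 - y < 1.
  by move=> /andP[y0 y1]; apply/andP; split; lra.
have fint : mu.-integrable `]0, 1[ (EFin \o f).
  apply: (@integrable_bounded_primitive _ f G (a^-1 + b^-1)).
  - by move=> y _; rewrite addr_ge0// powR_ge0.
  - move=> y; rewrite in_itv/= => /andP[y0 y1]; apply: is_derive1_continuous.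
    exact: is_derive1_add (is_derive1_pow _ y0) (is_derive1_pow_onem _ y1).
  - move=> y /andP[y0 y1].
    have h := is_derive1_sub
      (is_derive1_mul (is_derive1_pow a y0) (is_derive1_cst a^-1 y))
      (is_derive1_mul (is_derive1_pow_onem b y1) (is_derive1_cst b^-1 y)).
    apply: is_derive1_eq h _.
    rewrite /f !powR_pred ?subr_gt0//; field.
    by rewrite subr_eq0 !gt_eqF.
  - move=> y y01; apply: (le_trans (ler_normB _ _)); apply: lerD.
    + rewrite ger0_norm ?divr_ge0 ?powR_ge0 ?(ltW a0)//.
      by rewrite ler_piMl ?invr_ge0 ?(ltW a0)// pow_le1.
    + rewrite ger0_norm ?divr_ge0 ?powR_ge0 ?(ltW b0)//.
      by rewrite ler_piMl ?invr_ge0 ?(ltW b0)// pow_le1// oneB.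
apply: le_integrable fint => //.
  apply/measurable_EFinP; apply: continuous_measurable_itvoo => y.
  by rewrite in_itv/=; exact: continuous_beta_density.
move=> y; rewrite /= in_itv/= => y01; have /andP[y0 y1] := y01.
have y1' : 0 < 1 - y by rewrite subr_gt0.
rewrite lee_fin (ger0_norm (ltW (beta_density_gt0 a b y01))).
rewrite ger0_norm ?addr_ge0 ?powR_ge0// /beta_density /f.
have -> : y `^ (a - 1) * (1 - y) `^ (b - 1) =
    (1 - y) `^ b * y `^ (a - 1) + y `^ a * (1 - y) `^ (b - 1).
  by rewrite !powR_pred//; field; rewrite !gt_eqF.
by apply: lerD; rewrite ler_piMl ?powR_ge0// pow_le1// oneB.
Qed.

Lemma is_derive_incomplete_beta a b y : 0 < a -> 0 < b -> 0 < y < 1 ->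
  is_derive y 1 (fun y => incomplete_beta y a b) (beta_density a b y).
Proof.
move=> a0 b0 y01.
exact: (is_derive_Rintegral_oo (integrable_beta_density a0 b0) y01
  (@continuous_beta_density a b y y01)).
Qed.

Lemma incomplete_beta_cvg0 a b : 0 < a -> 0 < b ->
  incomplete_beta y a b @[y --> 0^'+] --> (0 : R).
Proof.
move=> a0 b0.
exact: (Rintegral_oo_cvg_right ltr01 (integrable_beta_density a0 b0)).
Qed.

Lemma incomplete_beta_cvg1 a b : 0 < a -> 0 < b ->
  incomplete_beta y a b @[y --> 1^'-] --> incomplete_beta 1 a b.
Proof.
move=> a0 b0.
exact: (Rintegral_oo_cvg_left ltr01 (integrable_beta_density a0 b0)).
Qed.

Lemma incomplete_beta_gt0 a b y : 0 < a -> 0 < b -> 0 < y <= 1 ->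
  0 < incomplete_beta y a b.
Proof.
move=> a0 b0 /andP[y0]; rewrite le_eqVlt => /predU1P[->|y1]; last first.
  apply: (@beta_primitive_gt0 _ a b (fun y => incomplete_beta y a b)).
  - by move=> z; exact: is_derive_incomplete_beta.
  - exact: incomplete_beta_cvg0.
  - by rewrite y0.
(* The derivative is only known inside []0, 1[], so the value at 1 is reached as the left limit of
   an increasing function and bounded below by the value at 1/2. *)
have h01 : 0 < (2^-1 : R) < 1 by apply/andP; split; lra.
apply: (@lt_le_trans _ _ (incomplete_beta 2^-1 a b)).
  apply: (@beta_primitive_gt0 _ a b (fun y => incomplete_beta y a b)) => //.
  - by move=> z; exact: is_derive_incomplete_beta.
  - exact: incomplete_beta_cvg0.
have h := incomplete_beta_cvg1 a0 b0.
rewrite -(cvg_lim _ h)//.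
apply: limr_ge; first by apply/cvg_ex; eexists; exact: h.
near=> z.
have z2 : 2^-1 < z.
  by near: z; apply: nbhs_left_gt; lra.
have z1 : z < 1 by near: z; exact: nbhs_left_lt.
apply/ltW; apply: (@derive1_gt0_lt _ (fun y => incomplete_beta y a b)
  (beta_density a b) 0 1) => //.
- by move=> t; exact: is_derive_incomplete_beta.
- by move=> t; exact: beta_density_gt0.
Unshelve. all: by end_near. Qed.

Lemma continuous_incomplete_beta_div a b y : 0 < a -> 0 < b -> 0 < y < 1 ->
  {for y, continuous (fun y => incomplete_beta y a b / (1 - y))}.
Proof.
move=> a0 b0 y01; have /andP[y0 y1] := y01; apply: is_derive1_continuous.
apply: is_derive1_div (is_derive_incomplete_beta a0 b0 y01)
  (is_derive1_sub (is_derive1_cst 1 y) (is_derive1_id y)) _.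
by rewrite subr_eq0 gt_eqF.
Qed.

(** The integrand is increasing, hence bounded by its value at [c]. The bound [c < 1] is essential:
    near 1 the integrand grows like a multiple of [1 / (1 - y)]. *)
Lemma integrable_incomplete_beta_div a b c : 0 < a -> 0 < b -> 0 < c < 1 ->
  mu.-integrable `]0, c[ (EFin \o (fun y => incomplete_beta y a b / (1 - y))).
Proof.
move=> a0 b0 /andP[c0 c1].
apply: measurable_bounded_integrable => //.
- by rewrite /= lebesgue_measure_itv/= lte_fin c0 -EFinB ltry.
- apply: continuous_measurable_itvoo => y; rewrite in_itv/= => /andP[y0 yc].
  by apply: continuous_incomplete_beta_div => //; rewrite y0 (lt_trans yc).
exists (incomplete_beta c a b / (1 - c)); split; first exact: num_real.
move=> N MN y; rewrite /= in_itv/= => /andP[y0 yc].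
apply: le_trans (ltW MN).
have y01 : 0 < y <= 1 by rewrite y0 ltW// (lt_trans yc).
rewrite ger0_norm; last first.
  by rewrite divr_ge0 ?subr_ge0 ?(ltW (incomplete_beta_gt0 _ _ _))// ltW// (lt_trans yc).
apply: ler_pM.
- exact/ltW/incomplete_beta_gt0.
- by rewrite invr_ge0 subr_ge0 ltW// (lt_trans yc).
- apply/ltW; apply: (@derive1_gt0_lt _ (fun y => incomplete_beta y a b)
    (beta_density a b) 0 1) => //.
  + by move=> t; exact: is_derive_incomplete_beta.
  + by move=> t; exact: beta_density_gt0.
- by rewrite lef_pV2 ?posrE ?subr_gt0 ?(lt_trans yc)//; lra.
Qed.

(** [K] is chosen before [v], so one tangent line at [w] serves for both endpoints of a convex
    combination. *)
Lemma incomplete_beta_reversed_hazard_tangent a w y : 0 < a -> 0 < w -> 0 < y < 1 ->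
  exists K, forall v, 0 < v -> v != w ->
  beta_density a w y / incomplete_beta y a w - (v - w) * K
  < beta_density a v y / incomplete_beta y a v.
Proof.
move=> a0 w0 y01.
pose L z := \int[mu]_(t in `]0, z[) (incomplete_beta t a w / (1 - t)).
exists (beta_density a w y * L y / incomplete_beta y a w ^+ 2) => v v0 vw.
apply: (@reversed_hazard_tangent _ a w (fun y => incomplete_beta y a w)
   _ _ _ _ L _ _ v (fun y => incomplete_beta y a v)) => //.
- by move=> z; exact: is_derive_incomplete_beta.
- exact: incomplete_beta_cvg0.
- move=> z /andP[z0 z1].
  (* The integrand of [L] is integrable only away from 1, so [L] is differentiated at [z] inside an
     interval ending midway between [z] and 1. *)
  have c01 : 0 < (1 + z) / 2 < 1 by apply/andP; split; lra.
  have zc : 0 < z < (1 + z) / 2 by apply/andP; split; lra.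
  apply: (is_derive_Rintegral_oo (integrable_incomplete_beta_div a0 w0 c01) zc).
  by apply: continuous_incomplete_beta_div => //; rewrite z0.
- have c01 : 0 < (2^-1 : R) < 1 by apply/andP; split; lra.
  have /andP[c0 _] := c01.
  exact: (Rintegral_oo_cvg_right c0 (integrable_incomplete_beta_div a0 w0 c01)).
- by move=> z; exact: is_derive_incomplete_beta.
- exact: incomplete_beta_cvg0.
Qed.

End incomplete_beta.

(** * Strict log-concavity from the tangent inequality at the convex combination *)

Theorem theorem1 (R : realType) (a x : R) (ha : 0 < a) (hx : 0 < x < 1) :
  strictly_log_concave_on `]0, +oo[
    (fun b : R => normalized_incomplete_beta x a b).
Proof.
have /andP[x0 x1] := hx.
have F_gt0 (b y : R) : 0 < b -> 0 < y <= 1 -> 0 < incomplete_beta y a b.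
  by move=> b0; exact: incomplete_beta_gt0.
have x01 : 0 < x <= 1 by rewrite x0 ltW.
have one01 : 0 < (1 : R) <= 1 by rewrite ltr01 lexx.
split.
  by move=> b /=; rewrite in_itv/= andbT => b0; rewrite divr_gt0 ?F_gt0.
move=> u v t /=; rewrite !in_itv/= !andbT => u0 v0 uv /andP[t0 t1].
have s0 : 0 < 1 - t by rewrite subr_gt0.
(* Stated for variables: on the integrals themselves, [lra] would spend minutes
   on conversion tests between atoms. *)
have combine (A A' B B' C C' : R) : t * A + (1 - t) * B - C <
    t * A' + (1 - t) * B' - C' -> t * (A - A') + (1 - t) * (B - B') < C - C'.
  lra.
set w := t * u + (1 - t) * v.
have w0 : 0 < w by rewrite addr_gt0// mulr_gt0.
pose D y := t * ln (incomplete_beta y a u) +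
  (1 - t) * ln (incomplete_beta y a v) - ln (incomplete_beta y a w).
have lnI (b : R) : 0 < b -> ln (normalized_incomplete_beta x a b) =
    ln (incomplete_beta x a b) - ln (incomplete_beta 1 a b).
  by move=> b0; rewrite ln_div ?posrE ?F_gt0.
suff DxD1 : D x < D 1.
  rewrite [X in _ < X](lnI w w0) [X in _ + _ * X < _](lnI v v0).
  by rewrite [X in _ * X + _ < _](lnI u u0); exact: combine DxD1.
have dD (y : R) : 0 < y < 1 -> is_derive y 1 D
    (t * (beta_density a u y / incomplete_beta y a u) +
     (1 - t) * (beta_density a v y / incomplete_beta y a v) -
     beta_density a w y / incomplete_beta y a w).
  move=> y01; have y01' : 0 < y <= 1 by case/andP: y01 => -> /ltW ->.
  have dln b (b0 : 0 < b) := is_derive1_ln_comp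
    (is_derive_incomplete_beta ha b0 y01) (F_gt0 _ _ b0 y01').
  have h := is_derive1_sub (is_derive1_add
    (is_derive1_mul (is_derive1_cst t y) (dln _ u0))
    (is_derive1_mul (is_derive1_cst (1 - t) y) (dln _ v0))) (dln _ w0).
  have simpl0 (p q A B C : R) :
      0 * p + t * A + (0 * q + (1 - t) * B) - C = t * A + (1 - t) * B - C.
    by rewrite !mul0r !add0r.
  exact: is_derive1_eq h (simpl0 _ _ _ _ _).
have D_lt (y z : R) : 0 < y -> y < z -> z < 1 -> D y < D z.
  apply: (derive1_gt0_lt dD) => {}y y01.
  have [K HK] := incomplete_beta_reversed_hazard_tangent ha w0 y01.
  have uw : u != w.
    rewrite -subr_eq0 (_ : u - w = (1 - t) * (u - v)); last by rewrite /w; ring.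
    by rewrite mulf_neq0 ?subr_eq0// gt_eqF.
  have vw : v != w.
    rewrite -subr_eq0 (_ : v - w = t * (v - u)); last by rewrite /w; ring.
    by rewrite mulf_neq0 ?(gt_eqF t0)// subr_eq0 eq_sym.
  (* As [w] is the weighted mean of [u] and [v], the linear terms of the tangent line average to
     zero; the weighted sum of the two tangent inequalities is then the positivity of the derivative
     of [D]. *)
  have meanE (C : R) :
      C = t * (C - (u - w) * K) + (1 - t) * (C - (v - w) * K).
    by rewrite /w; ring.
  have hu := HK u u0 uw; have hv := HK v v0 vw.
  rewrite -(ltr_pM2l t0) in hu; rewrite -(ltr_pM2l s0) in hv.
  by rewrite subr_gt0 [X in X < _]meanE; exact: ltrD hu hv.
(* The passage to the limit at 1 only preserves a weak inequality, so strictness is secured first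
   between [x] and the midpoint of [x] and 1. *)
have xm : x < (1 + x) / 2 by lra.
have m1 : (1 + x) / 2 < 1 by lra.
apply: lt_le_trans (D_lt _ _ x0 xm m1) _.
have D_cvg : D y @[y --> 1^'-] --> D 1.
  have lnF (b : R) : 0 < b ->
      ln (incomplete_beta y a b) @[y --> 1^'-] --> ln (incomplete_beta 1 a b).
    move=> b0; apply: continuous_cvg; last exact: incomplete_beta_cvg1.
    exact/is_derive1_continuous/is_derive1_ln/F_gt0.
  apply: cvgB; last exact: lnF.
  by apply: cvgD; apply: cvgM; [exact: cvg_cst|exact: lnF|exact: cvg_cst|exact: lnF].
rewrite -(cvg_lim _ D_cvg)//.
apply: limr_ge; first by apply/cvg_ex; eexists; exact: D_cvg.
near=> z.
have z1 : z < 1 by near: z; exact: nbhs_left_lt.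
have mz : (1 + x) / 2 < z by near: z; exact: nbhs_left_gt.
by apply/ltW; apply: D_lt => //; exact: lt_trans xm.
Unshelve. all: by end_near. Qed.
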